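(* The $D_4^{(1)}$ system (defined in the context) admits the affine Weyl group symmetry of type $D_4^{(1)}$ as the group of its Bäcklund transformations, whose generators are explicitly given as follows, with the notation $( * ):=(x,y,z;\alpha_0,\alpha_1,\ldots,\alpha_4)$: $$\begin{aligned} s_0:( * )&\rightarrow\left(x,y,z-\tfrac{\alpha_0}{x-\eta};-\alpha_0,\alpha_1,\alpha_2+\alpha_0,\alpha_3,\alpha_4\right),\\ s_1:( * )&\rightarrow\left(x,y,z-\tfrac{\alpha_1}{x};\alpha_0,-\alpha_1,\alpha_2+\alpha_1,\alpha_3,\alpha_4\right),\\ s_2:( * )&\rightarrow\left(x+\tfrac{\alpha_2}{z},y+\tfrac{\alpha_2}{z},z;\alpha_0+\alpha_2,\alpha_1+\alpha_2,-\alpha_2,\alpha_3+\alpha_2,\alpha_4+\alpha_2\right),\\ s_3:( * )&\rightarrow\left(x,y,z-\tfrac{\alpha_3}{y-1};\alpha_0,\alpha_1,\alpha_2+\alpha_3,-\alpha_3,\alpha_4\right),\\ s_4:( * )&\rightarrow\left(x,y,z-\tfrac{\alpha_4}{y};\alpha_0,\alpha_1,\alpha_2+\alpha_4,\alpha_3,-\alpha_4\right). \end{aligned}$$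
   Context: A Bäcklund transformation of a parametrized system is a birational transformation of the variables and parameters that takes the system with the original parameters to the system of the same form with the transformed parameters (here $\eta$ and $b(t)$ are unchanged). Affine Weyl group symmetry of type $D_4^{(1)}$ means that each $s_i$ is a Bäcklund transformation and that the $s_i$ satisfy the fundamental relations of the affine Weyl group of type $D_4^{(1)}$ (central node $2$): $s_i^2=1$, $(s_is_2)^3=1$ for $i\ne2$, $(s_is_j)^2=1$ for $i\neq j$ both different from $2$. The $D_4^{(1)}$ system. Let $\eta\in\mathbb{C}\setminus\{0\}$, let $b(t)\in\mathbb{C}(t)$ be nonzero, and let $\alpha_0,\dots,\alpha_4\in\mathbb{C}$ satisfy $\alpha_0+\alpha_1+2\alpha_2+\alpha_3+\alpha_4=1$. The $D_4^{(1)}$ system for unknown functions $x,y,z$ of $t$ is $$\frac{2\eta}{b(t)}\frac{dx}{dt}=P,\qquad -\frac{2\eta}{b(t)}\frac{dy}{dt}=Q,\qquad \frac{2\eta}{b(t)}\frac{dz}{dt}=R,$$ where $P=-2x(y-1)yz(x-\eta)(2x-2y+1-\eta)-2(2\alpha_0+2\alpha_1+4\alpha_2+\alpha_3+\alpha_4)x^3y-2(\alpha_0+\alpha_1)xy^3+(5\alpha_0+5\alpha_1+6\alpha_2+\alpha_3+\alpha_4)x^2y^2-\{5\alpha_0+5\alpha_1+6\alpha_2+2\alpha_3-3(2\alpha_0+2\alpha_1+4\alpha_2+\alpha_3+\alpha_4)\eta\}x^2y+\{3(\alpha_0+\alpha_1)-(4\alpha_0+6\alpha_1+6\alpha_2+\alpha_3+\alpha_4)\eta\}xy^2+x^4+2(\alpha_0+\alpha_1+2\alpha_2+\alpha_3-\eta)x^3+2\alpha_1\eta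 y^3+\{(\alpha_0+\alpha_1+2\alpha_2+\alpha_3)(\eta^2-3\eta+1)+\alpha_4\eta^2\}x^2+\alpha_1(\eta-3)\eta y^2+\{-(\alpha_0+\alpha_1)+2(2\alpha_0+3\alpha_1+3\alpha_2+\alpha_3)\eta-(2\alpha_0+2\alpha_1+4\alpha_2+\alpha_3+\alpha_4)\eta^2\}xy+(\alpha_0+\alpha_1+2\alpha_2+\alpha_3)(\eta-1)\eta x-\alpha_1(\eta-1)\eta y$, $Q=2x(y-1)yz(x-\eta)(2x-2y+1-\eta)-2(\alpha_3+\alpha_4)x^3y-2(\alpha_0+\alpha_1+4\alpha_2+2\alpha_3+2\alpha_4)xy^3+(\alpha_0+\alpha_1+6\alpha_2+5\alpha_3+5\alpha_4)x^2y^2+\{-(\alpha_0+\alpha_1+6\alpha_2+4\alpha_3+6\alpha_4)+3(\alpha_3+\alpha_4)\eta\}x^2y+\{3(\alpha_0+\alpha_1+4\alpha_2+2\alpha_3+2\alpha_4)-(2\alpha_0+6\alpha_2+5\alpha_3+5\alpha_4)\eta\}xy^2+y^4+2\alpha_4x^3+2\{(\alpha_0+2\alpha_2+\alpha_3+\alpha_4)\eta-1\}y^3-\alpha_4(3\eta-1)x^2+\{1-3(\alpha_0+2\alpha_2+\alpha_3+\alpha_4)\eta+(\alpha_0+2\alpha_2+\alpha_3+\alpha_4)\eta^2\}y^2+\{-(\alpha_0+\alpha_1+4\alpha_2+2\alpha_3+2\alpha_4)+2(\alpha_0+3\alpha_2+2\alpha_3+3\alpha_4)\eta-(\alpha_3+\alpha_4)\eta^2\}xy+\alpha_4(\eta-1)\eta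 x-(\alpha_0+2\alpha_2+\alpha_3+\alpha_4)(\eta-1)\eta y$, $R=(2x-2y+1-\eta)\{2x^2y+2xy^2-x^2-\eta y^2-2(\eta+1)xy+\eta(x+y)\}z^2+z\big[-2(\alpha_3+\alpha_4)x^3+2(\alpha_0+\alpha_1)y^3+2(\alpha_0+\alpha_1+6\alpha_2+2\alpha_3+2\alpha_4)x^2y-2(2\alpha_0+2\alpha_1+6\alpha_2+\alpha_3+\alpha_4)xy^2+\{-(\alpha_0+\alpha_1+6\alpha_2+4\alpha_3)+3(\alpha_3+\alpha_4)\eta\}x^2+\{-3(\alpha_0+\alpha_1)+(4\alpha_0+6\alpha_2+\alpha_3+\alpha_4)\eta\}y^2-4\{-(\alpha_0+\alpha_1+3\alpha_2+\alpha_3)+(\alpha_0+3\alpha_2+\alpha_3+\alpha_4)\eta\}xy+\{-(\alpha_0+\alpha_1+4\alpha_2+2\alpha_3)+2(\alpha_0+3\alpha_2+2\alpha_3)\eta-(\alpha_3+\alpha_4)\eta^2\}x+\{\alpha_0+\alpha_1-2(2\alpha_0+3\alpha_2+\alpha_3)\eta+(2\alpha_0+4\alpha_2+\alpha_3+\alpha_4)\eta^2\}y-(\alpha_0+2\alpha_2+\alpha_3)(\eta-1)\eta\big]+\alpha_2\big[(\alpha_0+\alpha_1+2\alpha_2-\alpha_3-\alpha_4)x^2+(\alpha_0+\alpha_1-2\alpha_2-\alpha_3-\alpha_4)y^2-2(\alpha_0+\alpha_1-\alpha_3-\alpha_4)xy+\{\alpha_0+\alpha_1-2\alpha_3-(2\alpha_0+2\alpha_2-\alpha_3-\alpha_4)\eta\}x+\{-\alpha_0-\alpha_1+2\alpha_2+2\alpha_3+(2\alpha_0-\alpha_3-\alpha_4)\eta\}y+(\eta-1)(\alpha_2+\alpha_3+(\alpha_0+\alpha_2)\eta)\big]$.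 *)

(* Defs.v *)
From mathcomp Require Import all_boot all_order all_algebra.
(* The notations of mpoly are rejected once those of MathComp-Analysis have been
   imported, so that it has to come first. *)
From mathcomp Require Export mpoly.
From mathcomp Require Import complex.
From mathcomp Require Import classical_sets reals topology normedtype derive.
Import numFieldNormedType.Exports.

Set Implicit Arguments.
Unset Strict Implicit.
Unset Printing Implicit Defensive.

Import GRing.Theory.

Local Open Scope ring_scope.

(* Parameters alpha_0, ..., alpha_4 are indexed by 'I_5; the literals 0, ..., 4
   below are the corresponding elements of 'I_5. *)

Definition normalized (F : pzRingType) (a : 'I_5 -> F) : Prop :=
  a 0 + a 1 + 2 * a 2 + a 3 + a 4 = 1.

Section System.
Variables (F : comPzRingType) (eta : F) (a : 'I_5 -> F) (x y z : F).

Let a0 := a 0.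
Let a1 := a 1.
Let a2 := a 2.
Let a3 := a 3.
Let a4 := a 4.

Definition D4P : F :=
  - 2 * x * (y - 1) * y * z * (x - eta) * (2 * x - 2 * y + 1 - eta)
  - 2 * (2 * a0 + 2 * a1 + 4 * a2 + a3 + a4) * x ^+ 3 * y
  - 2 * (a0 + a1) * x * y ^+ 3
  + (5 * a0 + 5 * a1 + 6 * a2 + a3 + a4) * x ^+ 2 * y ^+ 2
  - (5 * a0 + 5 * a1 + 6 * a2 + 2 * a3
     - 3 * (2 * a0 + 2 * a1 + 4 * a2 + a3 + a4) * eta) * x ^+ 2 * y
  + (3 * (a0 + a1) - (4 * a0 + 6 * a1 + 6 * a2 + a3 + a4) * eta) * x * y ^+ 2
  + x ^+ 4
  + 2 * (a0 + a1 + 2 * a2 + a3 - eta) * x ^+ 3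
  + 2 * a1 * eta * y ^+ 3
  + ((a0 + a1 + 2 * a2 + a3) * (eta ^+ 2 - 3 * eta + 1) + a4 * eta ^+ 2)
    * x ^+ 2
  + a1 * (eta - 3) * eta * y ^+ 2
  + (- (a0 + a1) + 2 * (2 * a0 + 3 * a1 + 3 * a2 + a3) * eta
     - (2 * a0 + 2 * a1 + 4 * a2 + a3 + a4) * eta ^+ 2) * x * y
  + (a0 + a1 + 2 * a2 + a3) * (eta - 1) * eta * x
  - a1 * (eta - 1) * eta * y.

Definition D4Q : F :=
  2 * x * (y - 1) * y * z * (x - eta) * (2 * x - 2 * y + 1 - eta)
  - 2 * (a3 + a4) * x ^+ 3 * y
  - 2 * (a0 + a1 + 4 * a2 + 2 * a3 + 2 * a4) * x * y ^+ 3
  + (a0 + a1 + 6 * a2 + 5 * a3 + 5 * a4) * x ^+ 2 * y ^+ 2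
  + (- (a0 + a1 + 6 * a2 + 4 * a3 + 6 * a4) + 3 * (a3 + a4) * eta)
    * x ^+ 2 * y
  + (3 * (a0 + a1 + 4 * a2 + 2 * a3 + 2 * a4)
     - (2 * a0 + 6 * a2 + 5 * a3 + 5 * a4) * eta) * x * y ^+ 2
  + y ^+ 4
  + 2 * a4 * x ^+ 3
  + 2 * ((a0 + 2 * a2 + a3 + a4) * eta - 1) * y ^+ 3
  - a4 * (3 * eta - 1) * x ^+ 2
  + (1 - 3 * (a0 + 2 * a2 + a3 + a4) * eta
     + (a0 + 2 * a2 + a3 + a4) * eta ^+ 2) * y ^+ 2
  + (- (a0 + a1 + 4 * a2 + 2 * a3 + 2 * a4)
     + 2 * (a0 + 3 * a2 + 2 * a3 + 3 * a4) * eta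
     - (a3 + a4) * eta ^+ 2) * x * y
  + a4 * (eta - 1) * eta * x
  - (a0 + 2 * a2 + a3 + a4) * (eta - 1) * eta * y.

Definition D4R : F :=
  (2 * x - 2 * y + 1 - eta)
  * (2 * x ^+ 2 * y + 2 * x * y ^+ 2 - x ^+ 2 - eta * y ^+ 2
     - 2 * (eta + 1) * x * y + eta * (x + y)) * z ^+ 2
  + z * (- 2 * (a3 + a4) * x ^+ 3
         + 2 * (a0 + a1) * y ^+ 3
         + 2 * (a0 + a1 + 6 * a2 + 2 * a3 + 2 * a4) * x ^+ 2 * y
         - 2 * (2 * a0 + 2 * a1 + 6 * a2 + a3 + a4) * x * y ^+ 2
         + (- (a0 + a1 + 6 * a2 + 4 * a3) + 3 * (a3 + a4) * eta) * x ^+ 2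
         + (- 3 * (a0 + a1) + (4 * a0 + 6 * a2 + a3 + a4) * eta) * y ^+ 2
         - 4 * (- (a0 + a1 + 3 * a2 + a3) + (a0 + 3 * a2 + a3 + a4) * eta)
           * x * y
         + (- (a0 + a1 + 4 * a2 + 2 * a3) + 2 * (a0 + 3 * a2 + 2 * a3) * eta
            - (a3 + a4) * eta ^+ 2) * x
         + (a0 + a1 - 2 * (2 * a0 + 3 * a2 + a3) * eta
            + (2 * a0 + 4 * a2 + a3 + a4) * eta ^+ 2) * y
         - (a0 + 2 * a2 + a3) * (eta - 1) * eta)
  + a2 * ((a0 + a1 + 2 * a2 - a3 - a4) * x ^+ 2
          + (a0 + a1 - 2 * a2 - a3 - a4) * y ^+ 2
          - 2 * (a0 + a1 - a3 - a4) * x * y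
          + (a0 + a1 - 2 * a3 - (2 * a0 + 2 * a2 - a3 - a4) * eta) * x
          + (- a0 - a1 + 2 * a2 + 2 * a3 + (2 * a0 - a3 - a4) * eta) * y
          + (eta - 1) * (a2 + a3 + (a0 + a2) * eta)).

End System.

(* [ratfun_value b t c]: the rational function b is regular at t (some
   representation of b has a denominator not vanishing at t) with value c. *)
Definition ratfun_value (F : fieldType) (b : {fraction {poly F}}) (t c : F) :
    Prop :=
  exists p q : {poly F},
    [/\ q.[t] != 0, b = tofrac p / tofrac q & c = p.[t] / q.[t]].

Definition mratfun_value (F : fieldType) (n : nat)
    (f : {fraction {mpoly F[n]}}) (v : 'I_n -> F) (c : F) : Prop :=
  exists p q : {mpoly F[n]},
    [/\ q.@[v] != 0, f = tofrac p / tofrac q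
      & c = p.@[v] / q.@[v]].

(* (x, y, z) is a holomorphic solution, on the set U, of the D_4^(1) system with
   parameters a; the coefficient 2 eta / b must make sense at each point of U.
   The derivatives are complex derivatives. *)
Definition solves_D4 (R : realType) (eta : R[i]) (b : {fraction {poly R[i]}})
    (a : 'I_5 -> R[i]) (U : set R[i]) (x y z : R[i]^o -> R[i]^o) : Prop :=
  forall t : R[i], U t ->
    [/\ derivable x t 1, derivable y t 1, derivable z t 1
      & exists c : R[i],
        [/\ ratfun_value b t c, c != 0,
            2 * eta / c * derive1 x t = D4P eta a (x t) (y t) (z t),
            - (2 * eta / c) * derive1 y t = D4Q eta a (x t) (y t) (z t)
          & 2 * eta / c * derive1 z t = D4R eta a (x t) (y t) (z t)]].

Section FunctionField.
Variable F : fieldType.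

(* Function field over F of the space of variables and parameters
   {(x, y, z, alpha) | normalized alpha}, on which x, y, z, alpha_1, ...,
   alpha_4 are coordinates. *)
Definition D4field : fieldType := {fraction {mpoly F[7]}}.

Definition D4const (c : F) : D4field := tofrac c%:MP.

Definition D4coord (k : 'I_7) : D4field := tofrac 'X_k.

Definition X : D4field := D4coord 0.
Definition Y : D4field := D4coord 1.
Definition Z : D4field := D4coord 2.

Definition al (i : 'I_5) : D4field :=
  [:: 1 - D4coord 3 - 2 * D4coord 4 - D4coord 5 - D4coord 6;
      D4coord 3; D4coord 4; D4coord 5; D4coord 6]`_i.

Definition D4star : seq D4field := [:: X; Y; Z; al 0; al 1; al 2; al 3; al 4].

Definition D4point (x y z : F) (a : 'I_5 -> F) (k : 'I_7) : F :=
  [:: x; y; z; a 1; a 2; a 3; a 4]`_k.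

(* A birational transformation over F is given by its comorphism, which maps
   each coordinate function to the corresponding component of the
   transformation. *)
Definition birational (s : {rmorphism D4field -> D4field}) : Prop :=
  (forall c, s (D4const c) = D4const c) /\ bijective s.

End FunctionField.

Arguments X {F}.
Arguments Y {F}.
Arguments Z {F}.
Arguments al {F}.
Arguments D4star {F}.

(* The second part says that s maps solutions to solutions wherever the
   transformed functions x', y', z' and parameters a' are defined. *)
Definition is_Backlund (R : realType) (eta : R[i]) (b : {fraction {poly R[i]}})
    (s : {rmorphism D4field R[i] -> D4field R[i]}) : Prop :=
  birational s /\
  forall (a a' : 'I_5 -> R[i]) (U : set R[i]) (x y z x' y' z' : R[i] -> R[i]),
    open (U : set R[i]^o) -> (exists t, U t) ->
    normalized a -> solves_D4 eta b a U x y z ->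
    (forall t, U t ->
      let v := D4point (x t) (y t) (z t) a in
      [/\ mratfun_value (s X) v (x' t), mratfun_value (s Y) v (y' t),
          mratfun_value (s Z) v (z' t)
        & forall i, mratfun_value (s (al i)) v (a' i)]) ->
    normalized a' /\ solves_D4 eta b a' U x' y' z'.

(* Comorphisms compose in the order opposite to that of the transformations,
   but reversing the words in these relations gives equivalent relations. *)
Definition affine_Weyl_D4_relations (T : Type) (s : 'I_5 -> T -> T) : Prop :=
  [/\ forall i, s i \o s i =1 id,
      forall i, i != 2 -> iter 3 (s i \o s 2) =1 id
    & forall i j, i != j -> i != 2 -> j != 2 -> iter 2 (s i \o s j) =1 id].

(* Main.v *)
Require Import Defs.
From HB Require Import structures.
From mathcomp Require Import all_boot all_order all_algebra fraction.
From mathcomp Require Import generic_quotient ring.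
From mathcomp Require Import complex classical_sets reals.
From mathcomp Require Import topology normedtype derive.
Import numFieldNormedType.Exports.

(** All five generators have one form.  Put f_0 = x - eta, f_1 = x, f_2 = z,
    f_3 = y - 1, f_4 = y, and let the bracket be given by {z, x} = {z, y} = 1
    and {x, y} = 0.  Then s_i sends each of the variables v to
    v + (alpha_i / f_i) {f_i, v}, which is a finite formula because {f_i, v} is
    a constant and {f_i, f_i} = 0, and it sends the parameters to their image
    under the i-th reflection of the D_4^(1) diagram.  Everything below is
    therefore stated for a generic i: [divisor] is f_i, [bracket_xy] and
    [bracket_z] are the constants {f_i, x} = {f_i, y} and {f_i, z}, and
    [weyl_refl] acts on the parameters.

    Covariance of the system.  Along a solution the new variable
    v + {f_i, v} alpha_i / f_i has derivative
    v' - {f_i, v} alpha_i f_i' / f_i^2, where f_i' is again given by the system.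
    That this is the right-hand side of the system at the new point and the
    new parameters is an identity between rational functions, which holds modulo
    the normalization of the parameters ([D4_equivariant]).

    Where the transformation is defined.  A solution is transformed wherever
    the components of s_i have a value, so one must know that this forces
    f_i <> 0, even at the points where alpha_i vanishes together with f_i.
    Restriction to a line on which f_i is constant and alpha_i is not settles it
    ([mratfun_value_denom], [shifted_value_den]).

    Birationality.  The formulas give a morphism phi from polynomials to rational
    functions.  It extends to the function field if it is injective, and
    injectivity has to come from the fact that s_i is an involution.  The trick is
    to ask, for a polynomial p, for polynomials N and D with phi p = N / D and
    phi N / phi D = p; such p are closed under sums and products, hence it
    suffices to treat the generators, and phi p = 0 then gives N = 0 and p = 0
    ([reversible_involution], [reflection_exists]).

    Relations.  Two automorphisms of the function field agree as soon as they do
    on constants, variables and parameters.  This reduces s_i s_j = s_j s_i and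
    s_i s_2 s_i = s_2 s_i s_2 to elementary fraction identities
    ([reflection_commute], [reflection_braid]), where all denominators are
    nonzero because they are images of nonzero elements under some s_j.  With
    s_i^2 = 1 this gives the relations of the affine Weyl group. *)

Set Implicit Arguments.
Unset Strict Implicit.
Unset Printing Implicit Defensive.
Import GRing.Theory.
Local Open Scope ring_scope.

(** * Reflections of the parameters *)

Lemma ord5_ind (P : 'I_5 -> Prop) :
  P 0 -> P 1 -> P 2 -> P 3 -> P 4 -> forall i, P i.
Proof.
move=> P0 P1 P2 P3 P4 [[|[|[|[|[|//]]]]] lti];
[move: P0|move: P1|move: P2|move: P3|move: P4]; congr (P _); exact: val_inj.
Qed.

Lemma ord7_ind (P : 'I_7 -> Prop) :
  P 0 -> P 1 -> P 2 -> P 3 -> P 4 -> P 5 -> P 6 -> forall i, P i.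
Proof.
move=> P0 P1 P2 P3 P4 P5 P6 [[|[|[|[|[|[|[|//]]]]]]] lti];
[move: P0|move: P1|move: P2|move: P3|move: P4|move: P5|move: P6];
congr (P _); exact: val_inj.
Qed.

Lemma normalized_alpha0 (F : comPzRingType) (a : 'I_5 -> F) :
  normalized a -> a 0 = 1 - a 1 - 2 * a 2 - a 3 - a 4.
Proof. by move=> na; rewrite -[X in _ = X - _ - _ - _ - _]na; ring. Qed.

(** The simple reflections of type D_4^(1): node 2 is joined to all others. *)
Definition weyl_refl (V : zmodType) (i : 'I_5) (a : 'I_5 -> V) (j : 'I_5) : V :=
  if j == i then - a i else if (i == 2) || (j == 2) then a j + a i else a j.

Lemma weyl_refl_normalized (F : comPzRingType) i (a : 'I_5 -> F) :
  normalized a -> normalized (weyl_refl i a).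
Proof.
rewrite /normalized => na; rewrite -[RHS]na; move: i {na}.
by apply: ord5_ind; rewrite /weyl_refl /=; ring.
Qed.

Lemma raddf_weyl_refl (U V : zmodType) (f : {additive U -> V}) i
    (a : 'I_5 -> U) j :
  f (weyl_refl i a j) = weyl_refl i (f \o a) j.
Proof.
rewrite /weyl_refl; case: ifP => _; first exact: raddfN.
by case: ifP => // _; exact: raddfD.
Qed.

Lemma eq_weyl_refl (V : zmodType) i (a b : 'I_5 -> V) :
  a =1 b -> weyl_refl i a =1 weyl_refl i b.
Proof. by move=> ab j; rewrite /weyl_refl !ab. Qed.

Lemma weyl_reflK (V : zmodType) i (a : 'I_5 -> V) :
  weyl_refl i (weyl_refl i a) =1 a.
Proof.
move=> j; rewrite /weyl_refl eqxx; case: eqVneq => [-> //|_]; first by rewrite opprK.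
by case: (_ || _); rewrite ?addrK.
Qed.

Lemma weyl_refl_commute (V : zmodType) i j (a : 'I_5 -> V) :
  i != j -> i != 2 -> j != 2 ->
  weyl_refl i (weyl_refl j a) =1 weyl_refl j (weyl_refl i a).
Proof.
move=> /negPf ij /negPf i2 /negPf j2 l.
rewrite /weyl_refl ij [j == i]eq_sym ij i2 j2 /=.
case: (eqVneq l i) => [->|_]; first by rewrite ij i2.
case: (eqVneq l j) => [->|_]; first by rewrite j2.
by case: (l == 2); rewrite // addrAC.
Qed.

Lemma weyl_refl_braid (V : comPzRingType) i (a : 'I_5 -> V) : i != 2 ->
  weyl_refl i (weyl_refl 2 (weyl_refl i a))
    =1 weyl_refl 2 (weyl_refl i (weyl_refl 2 a)).
Proof.
move=> /negPf i2 l; rewrite /weyl_refl eqxx i2 [2 == i]eq_sym i2 /=.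
case: (eqVneq l i) => [->|_]; first by rewrite eqxx i2 /=; ring.
by rewrite eqxx; case: (l == 2) => /=; ring.
Qed.

(** * The generators and the covariance of the system *)

(** The polynomials f_0, ..., f_4, by which the generators divide. *)
Definition divisor (F : pzRingType) (eta x y z : F) (i : 'I_5) : F :=
  [:: x - eta; x; z; y - 1; y]`_i.

(** The bracket of f_i with x, which is also its bracket with y, for the
    constant bracket with {z, x} = {z, y} = 1 and {x, y} = 0. *)
Definition bracket_xy (F : pzRingType) (i : 'I_5) : F :=
  if i == 2 then 1 else 0.

(** The bracket of f_i with z; it vanishes for i = 2, where f_i = z. *)
Definition bracket_z (F : pzRingType) (i : 'I_5) : F :=
  if i == 2 then 0 else -1.

Lemma rmorph_divisor (U V : pzRingType) (f : {rmorphism U -> V}) eta x y z i :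
  f (divisor eta x y z i) = divisor (f eta) (f x) (f y) (f z) i.
Proof. by elim/ord5_ind: i; rewrite /divisor /= ?rmorphB ?rmorph1. Qed.

Lemma rmorph_bracket_xy (U V : pzRingType) (f : {rmorphism U -> V}) i :
  f (bracket_xy U i) = bracket_xy V i.
Proof. by rewrite /bracket_xy; case: ifP; rewrite ?rmorph1 ?rmorph0. Qed.

Lemma rmorph_bracket_z (U V : pzRingType) (f : {rmorphism U -> V}) i :
  f (bracket_z U i) = bracket_z V i.
Proof. by rewrite /bracket_z; case: ifP; rewrite ?rmorphN ?rmorph1 ?rmorph0. Qed.

Section ReflectedStar.
Variables (L : fieldType) (eta x y z : L) (a : 'I_5 -> L).

Definition reflected_star i : seq L :=
  let q := a i / divisor eta x y z i in
  [:: x + bracket_xy L i * q; y + bracket_xy L i * q; z + bracket_z L i * q;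
      weyl_refl i a 0; weyl_refl i a 1; weyl_refl i a 2; weyl_refl i a 3;
      weyl_refl i a 4].

Lemma reflected_starE :
  [/\ reflected_star 0 = [:: x; y; z - a 0 / (x - eta);
                            - a 0; a 1; a 2 + a 0; a 3; a 4],
      reflected_star 1 = [:: x; y; z - a 1 / x;
                            a 0; - a 1; a 2 + a 1; a 3; a 4],
      reflected_star 2 = [:: x + a 2 / z; y + a 2 / z; z;
                            a 0 + a 2; a 1 + a 2; - a 2; a 3 + a 2; a 4 + a 2],
      reflected_star 3 = [:: x; y; z - a 3 / (y - 1);
                            a 0; a 1; a 2 + a 3; - a 3; a 4]
    & reflected_star 4 = [:: x; y; z - a 4 / y;
                            a 0; a 1; a 2 + a 4; a 3; - a 4]].
Proof.
by split; rewrite /reflected_star /bracket_xy /bracket_z /weyl_refl /divisor /=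
  ?mul0r ?addr0 ?mul1r ?mulN1r.
Qed.
End ReflectedStar.

Section Covariance.
Variables (F : fieldType) (eta x y z : F) (a : 'I_5 -> F).
Hypothesis na : normalized a.

Local Notation P := (D4P eta a x y z).
Local Notation Q := (D4Q eta a x y z).
Local Notation R := (D4R eta a x y z).

(** The change of variables v + {f_i, v} alpha_i / f_i turns the vector field of
    the system into the one with reflected parameters.  When time
    is scaled so that x, y, z have the derivatives P, - Q, R, f' is the derivative
    of f = f_i, and the right-hand sides are those of the new variables. *)
Lemma D4_equivariant i (f := divisor eta x y z i)
    (f' := [:: P; P; R; - Q; - Q]`_i)
    (x' := x + bracket_xy F i * (a i / f))
    (y' := y + bracket_xy F i * (a i / f))
    (z' := z + bracket_z F i * (a i / f)) :
  f != 0 ->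
  [/\ D4P eta (weyl_refl i a) x' y' z'
        = P - bracket_xy F i * a i * f' / f ^+ 2,
      - D4Q eta (weyl_refl i a) x' y' z'
        = - Q - bracket_xy F i * a i * f' / f ^+ 2
    & D4R eta (weyl_refl i a) x' y' z'
        = R - bracket_z F i * a i * f' / f ^+ 2].
Proof.
have a0E := normalized_alpha0 na.
rewrite {}/x' {}/y' {}/z' {}/f' {}/f; elim/ord5_ind: i;
rewrite /divisor /bracket_xy /bracket_z /= /D4P /D4Q /D4R /weyl_refl /= a0E => f0;
by split; field.
Qed.
End Covariance.

(** * Extending involutions to a field of fractions *)

Section FractionLift.
Variables (A : idomainType) (L : fieldType) (phi : {rmorphism A -> L}).

Lemma fraction_repr (f : {fraction A}) :
  exists2 nd : A * A, nd.2 != 0 & f = tofrac nd.1 / tofrac nd.2.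
Proof.
elim/quotW: f => -[[n d] /= d0]; exists (n, d) => //=.
apply: (canRL (mulfK _)); first by rewrite tofrac_eq0.
rewrite !piE; apply/eqmodP.
rewrite /= FracField.equivfE /FracField.mulf !numden_Ratio ?oner_neq0 ?mulr1 //=.
by rewrite mulrC.
Qed.

Lemma fraction_lift : injective phi ->
  exists s : {rmorphism {fraction A} -> L}, forall p, s (tofrac p) = phi p.
Proof.
move=> phi_inj.
have phi0 p : (phi p == 0) = (p == 0) by rewrite -(inj_eq phi_inj) rmorph0.
have repP (f : {fraction A}) :
    exists nd : A * A, (nd.2 != 0) && (f == tofrac nd.1 / tofrac nd.2).
  by have [nd nd0 ->] := fraction_repr f; exists nd; rewrite nd0 eqxx.
pose s f := phi (xchoose (repP f)).1 / phi (xchoose (repP f)).2.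
have sE n d : d != 0 -> s (tofrac n / tofrac d) = phi n / phi d.
  rewrite /s => d0; case/andP: (xchooseP (repP (tofrac n / tofrac d))).
  case: (xchoose _) => n' d' /= d'0.
  rewrite eqr_div ?tofrac_eq0 // -!tofracM tofrac_eq => /eqP nd.
  by apply/eqP; rewrite eqr_div ?phi0 // -!rmorphM nd.
have s_zmod : zmod_morphism s.
  move=> f g; have [[n d] /= d0 ->] := fraction_repr f.
  have [[m e] /= e0 ->] := fraction_repr g.
  rewrite -mulNr addf_div ?tofrac_eq0 // -!(tofracN, tofracM, tofracD).
  rewrite !sE ?mulf_neq0 // -mulNr addf_div ?phi0 //.
  by rewrite !(rmorphM, rmorphD, rmorphN).
have s_mon : monoid_morphism s.
  split; first by rewrite -[1]divr1 -tofrac1 sE ?oner_neq0 // rmorph1 divr1.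
  move=> f g; have [[n d] /= d0 ->] := fraction_repr f.
  have [[m e] /= e0 ->] := fraction_repr g.
  by rewrite mulf_div -!tofracM !sE ?mulf_neq0 // mulf_div !rmorphM.
pose sZ := GRing.isZmodMorphism.Build _ _ s s_zmod.
pose sM := GRing.isMonoidMorphism.Build _ _ s s_mon.
pose S : {rmorphism {fraction A} -> L} := HB.pack s sZ sM.
exists S => p; rewrite /S /=.
by rewrite -[tofrac p]divr1 -tofrac1 sE ?oner_neq0 // rmorph1 divr1.
Qed.
End FractionLift.

Section Reversible.
Variables (A : idomainType) (phi : {rmorphism A -> {fraction A}}).

(** phi p = N / D is sent back to p by the extension of phi to fractions: phi is
    an involution at p, expressed before that extension is known to exist. *)
Definition reversible (p : A) := exists N D : A,
  [/\ phi D != 0, phi p = tofrac N / tofrac D & phi N = tofrac p * phi D].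

Lemma tofrac_neq0_of_image D : phi D != 0 -> tofrac D != 0 :> {fraction A}.
Proof.
by apply: contraNneq => /eqP; rewrite tofrac_eq0 => /eqP ->; rewrite rmorph0.
Qed.

Lemma reversibleD p q : reversible p -> reversible q -> reversible (p + q).
Proof.
move=> [N [D [sD pE NE]]] [M [E [sE qE ME]]].
exists (N * E + M * D), (D * E); split.
- by rewrite [phi _]rmorphM mulf_neq0.
- by rewrite rmorphD pE qE addf_div ?tofrac_neq0_of_image // -!tofracM -tofracD.
- rewrite rmorphD !rmorphM NE ME tofracD mulrDl !mulrA.
  by rewrite [_ * phi E * phi D]mulrAC.
Qed.

Lemma reversibleM p q : reversible p -> reversible q -> reversible (p * q).
Proof.
move=> [N [D [sD pE NE]]] [M [E [sE qE ME]]].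
exists (N * M), (D * E); split.
- by rewrite [phi _]rmorphM mulf_neq0.
- by rewrite rmorphM pE qE mulf_div -!tofracM.
- by rewrite !rmorphM NE ME mulrACA.
Qed.

(** If phi p = N / D vanishes then N = 0, and phi N = p phi D gives p = 0.  So phi
    is injective and extends to fractions. *)
Lemma reversible_involution : (forall p, reversible p) ->
  exists2 s : {rmorphism {fraction A} -> {fraction A}},
    forall p, s (tofrac p) = phi p & involutive s.
Proof.
move=> rev.
have phi_inj : injective phi.
  apply: raddf_inj => p p0; have [N [D [sD pE NE]]] := rev p.
  move/eqP: pE; rewrite [phi p]p0 eq_sym mulf_eq0 invr_eq0.
  rewrite (negPf (tofrac_neq0_of_image sD)) orbF tofrac_eq0 => /eqP N0.
  apply/eqP; rewrite -tofrac_eq0.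
  by have /eqP := NE; rewrite N0 rmorph0 eq_sym mulf_eq0 (negPf sD) orbF.
have [s sE] := fraction_lift phi_inj; exists s => // f.
have ssE p : s (s (tofrac p)) = tofrac p.
  have [N [D [sD pE NE]]] := rev p.
  by rewrite sE pE fmorph_div !sE NE mulfK.
by have [nd _ ->] := fraction_repr f; rewrite !fmorph_div !ssE.
Qed.
End Reversible.

(** * The reflections as automorphisms of the function field *)

Section FunctionField.
Variable F : fieldType.
Local Notation mp := {mpoly F[7]}.
Local Notation K := (D4field F).

Lemma D4field_ext (f g : {rmorphism K -> K}) :
  (forall c, f (D4const c) = g (D4const c)) ->
  (forall k, f (D4coord F k) = g (D4coord F k)) -> f =1 g.
Proof.
move=> fgC fgX.
suff fgp (p : mp) : f (tofrac p) = g (tofrac p).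
  by move=> h; have [nd _ ->] := fraction_repr h; rewrite !fmorph_div !fgp.
elim/mpolyind: p => [|c m p _ _ IHp]; first by rewrite !rmorph0.
rewrite -mul_mpolyC !(rmorphD, rmorphM) IHp; congr (_ * _ + _); first exact: fgC.
rewrite mpolyXE_id !rmorph_prod; apply: eq_bigr => k _.
by rewrite !rmorphXn fgX.
Qed.

Lemma D4field_involution (phi : {rmorphism mp -> K}) :
  (forall c, phi c%:MP = D4const c) ->
  (forall k, reversible phi 'X_k) ->
  exists2 s : {rmorphism K -> K}, forall p, s (tofrac p) = phi p & involutive s.
Proof.
move=> phiC revX.
have revC c : reversible phi c%:MP.
  exists c%:MP, 1; rewrite rmorph1 oner_neq0 tofrac1 divr1 mulr1.
  by split=> //; exact: phiC.
have rev p : reversible phi p.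
  elim/mpolyind: p => [|c m p _ _ IHp]; first by rewrite -mpolyC0.
  apply: reversibleD => //; rewrite -mul_mpolyC; apply: reversibleM => //.
  rewrite mpolyXE_id; elim/big_ind: _ => [|p1 p2|k _]; first exact: revC.
  - exact: reversibleM.
  by elim: (m k) => [|j IHj]; [exact: revC | rewrite exprS; apply: reversibleM].
exact: reversible_involution rev.
Qed.
End FunctionField.

Section Generators.
Variable F : fieldType.
Local Notation mp := {mpoly F[7]}.
Local Notation K := (D4field F).
Variable eta : F.

Definition al_poly (i : 'I_5) : mp :=
  [:: 1 - 'X_3 - 2 * 'X_4 - 'X_5 - 'X_6; 'X_3; 'X_4; 'X_5; 'X_6]`_i.

Definition divisor_poly : 'I_5 -> mp := divisor eta%:MP 'X_0 'X_1 'X_2.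

Definition divisor_fun : 'I_5 -> K := divisor (D4const eta) X Y Z.

Lemma tofrac_al_poly i : tofrac (al_poly i) = al i :> K.
Proof.
by elim/ord5_ind: i; rewrite // /al_poly /al /= !tofracB tofracM tofracD tofrac1.
Qed.

Lemma tofrac_divisor_poly i : tofrac (divisor_poly i) = divisor_fun i.
Proof. exact: (rmorph_divisor (@tofrac mp)). Qed.

Lemma normalized_al : normalized (@al F).
Proof. by rewrite /normalized /al /=; ring. Qed.

Lemma meval_al_poly (x y z : F) (a : 'I_5 -> F) j :
  normalized a -> (al_poly j).@[D4point x y z a] = a j.
Proof.
move=> na; elim/ord5_ind: j; rewrite /al_poly /= ?mevalXU //.
by rewrite (normalized_alpha0 na) !rmorphB rmorphM rmorphD rmorph1 /= !mevalXU.
Qed.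

Lemma meval_divisor_poly (x y z : F) (a : 'I_5 -> F) i :
  (divisor_poly i).@[D4point x y z a] = divisor eta x y z i.
Proof.
rewrite /divisor_poly (rmorph_divisor (meval (D4point x y z a))) /=.
by rewrite mevalC !mevalXU.
Qed.

Lemma divisor_poly_neq0 i : divisor_poly i != 0.
Proof.
(* A point off the hypersurface f_i = 0. *)
pose v := D4point (if i == 0 then eta + 1 else 1) (if i == 3 then 0 else 1) 1
  (fun=> 0).
suff: (divisor_poly i).@[v] != 0 by apply: contraNneq => ->; rewrite meval0.
rewrite meval_divisor_poly {}/v.
elim/ord5_ind: i; rewrite /divisor /= ?oner_neq0 //.
  by rewrite addrAC subrr add0r oner_neq0.
by rewrite sub0r oppr_eq0 oner_neq0.
Qed.

Lemma divisor_fun_neq0 i : divisor_fun i != 0.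
Proof. by rewrite -tofrac_divisor_poly tofrac_eq0 divisor_poly_neq0. Qed.

(** The action of s_i on all of the generators of the function field at once,
    al 0 included, together with the fact that it is an involution. *)
Definition is_reflection i (s : {rmorphism K -> K}) :=
  [/\ forall c, s (D4const c) = D4const c,
      [/\ s X = X + bracket_xy _ i * (al i / divisor_fun i),
          s Y = Y + bracket_xy _ i * (al i / divisor_fun i)
        & s Z = Z + bracket_z _ i * (al i / divisor_fun i)],
      forall j, s (al j) = weyl_refl i al j & involutive s].

(** Every coordinate is reversible: v + c alpha_i / f_i is the fraction
    (v f_i + c alpha_i) / f_i, and since f_i is fixed and alpha_i changes its
    sign, its numerator is sent to v f_i. *)
Lemma reflection_exists i : exists s, is_reflection i s.
Proof.
pose h := D4point (X + bracket_xy _ i * (al i / divisor_fun i))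
  (Y + bracket_xy _ i * (al i / divisor_fun i))
  (Z + bracket_z _ i * (al i / divisor_fun i)) (weyl_refl i al).
pose phi0 : {rmorphism mp -> K} := mmap (@tofrac _ \o @mpolyC 7 F) h.
have [phi phiC phiX] : exists2 phi : {rmorphism mp -> K},
    forall c, phi c%:MP = D4const c & forall k, phi 'X_k = h k.
  exists phi0 => [c|k]; first exact: mmapC.
  by rewrite /phi0 /= mmapX mmap1U.
(* The coordinates omit alpha_0, whose image follows from the normalization. *)
have phial j : phi (al_poly j) = weyl_refl i al j.
  move: j; apply: ord5_ind; try exact: phiX.
  rewrite (normalized_alpha0 (weyl_refl_normalized i normalized_al)).
  rewrite /al_poly /= !rmorphB rmorphM rmorphD rmorph1.
  by congr (_ - _ - _ * _ - _ - _); exact: phiX.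
have phiden : phi (divisor_poly i) = divisor_fun i.
  rewrite /divisor_poly rmorph_divisor phiC !phiX /divisor_fun /h /D4point /=.
  move: i {h phi0 phiX phial}; apply: ord5_ind => //=;
  by rewrite /divisor /bracket_xy /bracket_z /= ?mul0r ?addr0.
have revc k (c : mp) (c' : K) :
    h k = D4coord F k + c' * (al i / divisor_fun i) ->
    phi c = c' -> tofrac c = c' -> reversible phi 'X_k.
  move=> hk phic c'E.
  exists ('X_k * divisor_poly i + c * al_poly i), (divisor_poly i); split.
  - by rewrite phiden divisor_fun_neq0.
  - rewrite phiX hk tofracD !tofracM tofrac_al_poly tofrac_divisor_poly c'E.
    by rewrite mulrDl mulfK ?divisor_fun_neq0 // mulrA.
  - rewrite [LHS]rmorphD ![phi (_ * _)]rmorphM phic phial phiden phiX hk.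
    rewrite /weyl_refl eqxx mulrDl mulrN -!mulrA mulVf ?divisor_fun_neq0 //.
    by rewrite mulr1 addrK.
have revxy := revc _ (bracket_xy _ i) _ _
  (rmorph_bracket_xy phi i) (rmorph_bracket_xy (@tofrac mp) i).
have revz := revc _ (bracket_z _ i) _ _
  (rmorph_bracket_z phi i) (rmorph_bracket_z (@tofrac mp) i).
have reval j k : h k = weyl_refl i al j -> D4coord F k = al j ->
    reversible phi 'X_k.
  move=> hk kj; exists (weyl_refl i al_poly j), 1; split.
  - by rewrite rmorph1 oner_neq0.
  - rewrite phiX hk tofrac1 divr1 (raddf_weyl_refl (@tofrac mp)).
    by apply: eq_weyl_refl => l; rewrite /= tofrac_al_poly.
  - rewrite rmorph1 mulr1 raddf_weyl_refl.
    rewrite (eq_weyl_refl i (phial : phi \o al_poly =1 weyl_refl i al)).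
    rewrite weyl_reflK; exact/esym.
have [|s sE ss] := D4field_involution phiC.
  apply: ord7_ind; [exact: revxy|exact: revxy|exact: revz|exact: (reval 1)
    |exact: (reval 2)|exact: (reval 3)|exact: (reval 4)].
exists s; split=> // [c||j]; first by rewrite -[RHS]phiC; exact: sE.
  split.
  - exact: etrans (sE 'X_0) (phiX 0).
  - exact: etrans (sE 'X_1) (phiX 1).
  - exact: etrans (sE 'X_2) (phiX 2).
by rewrite -tofrac_al_poly sE.
Qed.
End Generators.

(** * The relations of the affine Weyl group *)

Section Relations.
Variables (F : fieldType) (eta : F).
Local Notation K := (D4field F).
Local Notation f_ := (divisor_fun eta).

Lemma XYZ_al_ext (f g : {rmorphism K -> K}) :
  (forall c, f (D4const c) = g (D4const c)) ->
  f X = g X -> f Y = g Y -> f Z = g Z -> (forall j, f (al j) = g (al j)) ->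
  f =1 g.
Proof.
move=> fgC fgX fgY fgZ fgal; apply: D4field_ext => //.
by apply: ord7_ind; [exact: fgX|exact: fgY|exact: fgZ|exact: (fgal 1)
  |exact: (fgal 2)|exact: (fgal 3)|exact: (fgal 4)].
Qed.

Lemma reflection_comp_al (i j : 'I_5) (s t : {rmorphism K -> K}) :
  is_reflection eta i s -> is_reflection eta j t ->
  forall l, s (t (al l)) = weyl_refl j (weyl_refl i al) l.
Proof.
move=> [_ _ sal _] [_ _ tal _] l.
by rewrite tal raddf_weyl_refl (eq_weyl_refl j sal).
Qed.

(** The bracket of f_j with f_i, for i <> 2, is its bracket with x: both vanish
    unless j = 2, and f_i is x or y up to a constant. *)
Lemma reflection_divisor i j (s : {rmorphism K -> K}) :
  is_reflection eta j s -> i != 2 ->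
  s (f_ i) = f_ i + bracket_xy _ j * (al j / f_ j).
Proof.
move=> [sC [sX sY sZ] _ _]; rewrite /divisor_fun rmorph_divisor sC sX sY sZ.
by move: i; apply: ord5_ind => //= _; rewrite /divisor /= addrAC.
Qed.

Lemma reflection_commute i j (s t : {rmorphism K -> K}) :
  is_reflection eta i s -> is_reflection eta j t -> i != j -> i != 2 -> j != 2 ->
  forall f, s (t f) = t (s f).
Proof.
move=> si tj ij i2 j2.
have sf := reflection_divisor si j2; have tf := reflection_divisor tj i2.
have alst l : s (t (al l)) = t (s (al l)).
  rewrite (reflection_comp_al si tj) (reflection_comp_al tj si).
  by rewrite weyl_refl_commute // eq_sym.
case: si tj => [sC [sX sY sZ] sal _] [tC [tX tY tZ] tal _].
have xy0 k : k != 2 -> bracket_xy K k = 0 by rewrite /bracket_xy => /negPf ->.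
move: sX sY sZ tX tY tZ sf tf; rewrite !xy0 // !mul0r !addr0.
move=> sX sY sZ tX tY tZ sf tf.
apply: (XYZ_al_ext (f := s \o t) (g := t \o s)) => [c||||] //=.
- by rewrite tC sC tC.
- by rewrite tX sX tX.
- by rewrite tY sY tY.
have salj : s (al j) = al j.
  by rewrite sal /weyl_refl eq_sym (negPf ij) (negPf i2) (negPf j2).
have tali : t (al i) = al i.
  by rewrite tal /weyl_refl (negPf ij) (negPf i2) (negPf j2).
rewrite tZ sZ !rmorphD !rmorphM !fmorphV !rmorph_bracket_z sZ tZ salj tali sf tf.
by rewrite addrAC.
Qed.

(** Both sides of the braid relation at x (or y) and at z.  Here d, a, b stand
    for f_i, alpha_i, alpha_2, so that z - a / d is s_i z and d + b / z is
    s_2 f_i. *)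
Lemma braid_identities (L : fieldType) (x z a b d : L) :
  z != 0 -> d != 0 -> z - a / d != 0 -> d + b / z != 0 ->
  x + (b + a) / (z - a / d)
    = x + b / z + (- b + (a + b)) / (z - (a + b) / (d + b / z)) /\
  z - a / d - (- a + (b + a)) / (d + (b + a) / (z - a / d))
    = z - (a + b) / (d + b / z).
Proof.
move=> z0 d0 zad dbz.
have n1 : z * d - a != 0.
  by apply: contraNneq zad => e; rewrite -(mulfK d0 z) -mulrBl e mul0r.
have n2 : d * z + b != 0.
  by apply: contraNneq dbz => e; rewrite -{1}(mulfK z0 d) -mulrDl e mul0r.
split; field; rewrite ?z0 ?d0 ?n1 ?n2 /= ?andbT.
- have -> : z * (d * z + b) - (a + b) * z = z * (z * d - a) by ring.
  by rewrite mulf_neq0.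
- have -> : d * (z * d - a) + (b + a) * d = d * (d * z + b) by ring.
  by rewrite mulf_neq0.
Qed.

Lemma reflection_braid i (s t : {rmorphism K -> K}) :
  is_reflection eta i s -> is_reflection eta 2 t -> i != 2 ->
  forall f, s (t (s f)) = t (s (t f)).
Proof.
move=> si t2 i2.
have sf := reflection_divisor si i2; have tf := reflection_divisor t2 i2.
have alsts l : s (t (s (al l))) = t (s (t (al l))).
  have [_ _ sal _] := si; have [_ _ tal _] := t2.
  rewrite sal tal !raddf_weyl_refl.
  rewrite (eq_weyl_refl i (reflection_comp_al si t2 : s \o (t \o al) =1 _)).
  rewrite (eq_weyl_refl 2 (reflection_comp_al t2 si : t \o (s \o al) =1 _)).
  by rewrite weyl_refl_braid.
case: si t2 => [sC [sX sY sZ] sal _] [tC [tX tY tZ] tal _].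
have f2 : f_ 2 = Z by [].
move: sX sY sZ tX tY tZ sf tf.
rewrite f2 /bracket_xy /bracket_z (negPf i2) eqxx !mul0r !mul1r !addr0 !mulN1r.
move=> sX sY sZ tX tY tZ sf tf.
have Z0 : Z != 0 :> K := divisor_fun_neq0 eta 2.
have f0 := divisor_fun_neq0 eta i.
have sZ0 : Z - al i / f_ i != 0 by rewrite -sZ fmorph_eq0.
have tf0 : f_ i + al 2 / Z != 0 by rewrite -tf fmorph_eq0.
have sal2 : s (al 2) = al 2 + al i.
  by rewrite sal /weyl_refl [2 == i]eq_sym (negPf i2) orbT.
have tali : t (al i) = al i + al 2 by rewrite tal /weyl_refl (negPf i2).
have sali : s (al i) = - al i by rewrite sal /weyl_refl eqxx.
have tal2 : t (al 2) = - al 2 by rewrite tal /weyl_refl eqxx.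
have fracD (h : {rmorphism K -> K}) u v w : h (u + v / w) = h u + h v / h w.
  by rewrite rmorphD fmorph_div.
have fracB (h : {rmorphism K -> K}) u v w : h (u - v / w) = h u - h v / h w.
  by rewrite rmorphB fmorph_div.
apply: (XYZ_al_ext (f := s \o t \o s) (g := t \o s \o t)) => [c||||] //=.
- by rewrite !(tC, sC).
- rewrite sX !tX !fracD sX sal2 sZ [t (_ + _)]rmorphD fracB tX tal2 tali tf tZ.
  by have [-> _] := braid_identities X Z0 f0 sZ0 tf0.
- rewrite sY !tY !fracD sY sal2 sZ [t (_ + _)]rmorphD fracB tY tal2 tali tf tZ.
  by have [-> _] := braid_identities Y Z0 f0 sZ0 tf0.
- rewrite tZ sZ !fracB tZ tali tf sZ fracD [s (_ + _)]rmorphD sali sal2 sf sZ.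
  by have [_ ->] := braid_identities X Z0 f0 sZ0 tf0.
Qed.

Lemma reflection_relations (s : 'I_5 -> {rmorphism K -> K}) :
  (forall i, is_reflection eta i (s i)) ->
  affine_Weyl_D4_relations (fun i f => s i f).
Proof.
move=> sP; have ss i f : s i (s i f) = f by have [_ _ _] := sP i; exact.
split=> [i|i i2|i j ij i2 j2] f /=; first exact: ss.
- by rewrite -(reflection_braid (sP i) (sP 2) i2) !ss.
- by rewrite (reflection_commute (sP i) (sP j) ij i2 j2) !ss.
Qed.
End Relations.

(** * Values of the transformed coordinates at a point *)

Section RationalValues.
Variables (F : fieldType) (n : nat).
Implicit Types (p q : {mpoly F[n]}) (v e : 'I_n -> F).

Definition on_line v e : {mpoly F[n]} -> {poly F} :=
  mmap (@polyC F) (fun k => (v k)%:P + (e k)%:P * 'X).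

HB.instance Definition _ v e := GRing.RMorphism.on (on_line v e).

Lemma on_line_at0 v e p : (on_line v e p).[0] = p.@[v].
Proof.
rewrite /on_line /meval /mmap horner_sum; apply: eq_bigr => m _.
rewrite hornerM hornerC /mmap1 horner_prod; congr (_ * _).
by apply: eq_bigr => k _; rewrite horner_exp !hornerE.
Qed.

Lemma on_lineX v e k : on_line v e 'X_k = (v k)%:P + (e k)%:P * 'X.
Proof. by rewrite /on_line mmapX mmap1U. Qed.

Lemma on_lineC v e c : on_line v e c%:MP = c%:P.
Proof. exact: mmapC. Qed.

Lemma mratfun_valueE p q v c : mratfun_value (tofrac p / tofrac q) v c ->
  q.@[v] != 0 -> c = p.@[v] / q.@[v].
Proof.
move=> [p' [q' [q'v pq ->]]] qv.
have neq0 r : r.@[v] != 0 -> tofrac r != 0 :> {fraction {mpoly F[n]}}.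
  by apply: contraNneq => /eqP; rewrite tofrac_eq0 => /eqP ->; rewrite meval0.
apply/eqP; rewrite eqr_div // -!mevalM; apply/eqP; congr (_.@[v]).
by apply/eqP; rewrite -tofrac_eq !tofracM -eqr_div ?neq0 // pq.
Qed.

(** If p / q = p' / q' with q' nonzero at v, then p q' = p' q.  On a line through
    v where q vanishes identically but p does not, this would make q' vanish
    identically, in particular at v. *)
Lemma mratfun_value_denom p q v e c : mratfun_value (tofrac p / tofrac q) v c ->
  q != 0 -> on_line v e p != 0 -> on_line v e q != 0.
Proof.
move=> [p' [q' [q'v pq _]]] q0 lp0; apply: contraNneq (q'v) => lq0.
have q'0 : q' != 0 by apply: contraNneq (q'v) => ->; rewrite meval0.
have : p * q' == p' * q.
  by rewrite -tofrac_eq !tofracM -eqr_div ?tofrac_eq0 // pq.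
move/eqP/(congr1 (on_line v e)); rewrite !rmorphM /= lq0 mulr0 => /eqP.
rewrite mulf_eq0 (negPf lp0) /= => /eqP lq'0.
by rewrite -(on_line_at0 v e) lq'0 horner0.
Qed.
End RationalValues.

Section ReflectionValues.
Variables (F : fieldType) (eta x y z : F) (a : 'I_5 -> F).
Hypothesis na : normalized a.
Local Notation mp := {mpoly F[7]}.
Local Notation K := (D4field F).
Local Notation v := (D4point x y z a).
Local Notation f_ := (divisor eta x y z).

(** A tangent vector to the space of normalized parameters along which every
    alpha_i varies: the increments (1, 1, -1, 1, -1) of alpha_0, ..., alpha_4
    satisfy 1 + 1 + 2 (-1) + 1 - 1 = 0.  The variables x, y, z, hence all the
    f_i, stay constant. *)
Definition direction : 'I_7 -> F :=
  D4point 0 0 0 (fun i => [:: 1; 1; -1; 1; -1]`_i).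
Local Notation line := (on_line v direction).

Lemma line_al_poly_neq0 i : line (al_poly F i) != 0.
Proof.
pose e (j : 'I_5) : F := [:: 1; 1; -1; 1; -1]`_j.
have e0 j : e j != 0.
  by elim/ord5_ind: j; rewrite /e /= ?oppr_eq0 oner_neq0.
suff -> : line (al_poly F i) = (a i)%:P + (e i)%:P * 'X.
  apply/eqP => /(congr1 (fun p : {poly F} => p`_1)).
  rewrite coefD coefC add0r coefCM coefX mulr1 coef0; exact/eqP/e0.
move: i; apply: ord5_ind; try exact: on_lineX.
rewrite /al_poly /= !rmorphB rmorphM rmorphD rmorph1 /= !on_lineX /=.
rewrite (normalized_alpha0 na) /e /=.
by rewrite !rmorphB rmorphM rmorphD rmorphN rmorph1; ring.
Qed.

Lemma line_divisor_poly i : line (divisor_poly eta i) = (f_ i)%:P.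
Proof.
rewrite /divisor_poly (rmorph_divisor (on_line v direction)) /= on_lineC.
rewrite !on_lineX /direction /D4point /= !mul0r !addr0.
exact/esym/(rmorph_divisor (@polyC F)).
Qed.

Lemma shifted_fraction i (w c : mp) :
  tofrac w + tofrac c * (al i / divisor_fun eta i) =
  tofrac (w * divisor_poly eta i + c * al_poly F i)
    / tofrac (divisor_poly eta i) :> K.
Proof.
rewrite tofracD !tofracM tofrac_al_poly tofrac_divisor_poly.
by rewrite mulrDl mulfK ?divisor_fun_neq0 // mulrA.
Qed.

Lemma shifted_value i (w c : mp) r :
  mratfun_value (tofrac w + tofrac c * (al i / divisor_fun eta i)) v r ->
  f_ i != 0 -> r = w.@[v] + c.@[v] * (a i / f_ i).
Proof.
rewrite shifted_fraction => /mratfun_valueE; rewrite meval_divisor_poly => H d0.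
rewrite H // mevalD !mevalM meval_divisor_poly meval_al_poly //.
by rewrite mulrDl mulfK // mulrA.
Qed.

(** The numerator w f_i + c alpha_i may vanish together with f_i at the given
    point, when alpha_i = 0 there.  But if f_i were zero, then on the line it
    would be c alpha_i, which is not identically zero. *)
Lemma shifted_value_den i (w c : mp) r :
  mratfun_value (tofrac w + tofrac c * (al i / divisor_fun eta i)) v r ->
  line c != 0 -> f_ i != 0.
Proof.
rewrite shifted_fraction => H c0; apply/eqP => d0.
have ld0 : line (divisor_poly eta i) = 0 by rewrite line_divisor_poly d0.
have lN : line (w * divisor_poly eta i + c * al_poly F i) != 0.
  by rewrite rmorphD !rmorphM /= ld0 mulr0 add0r mulf_neq0 // line_al_poly_neq0.
by have := mratfun_value_denom H (divisor_poly_neq0 eta i) lN; rewrite ld0 eqxx.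
Qed.

(** For i = 2 the pole of s_i x shows that f_i is nonzero, and for the other i
    the pole of s_i z does. *)
Lemma reflection_values i (s : {rmorphism K -> K}) (x' y' z' : F)
    (a' : 'I_5 -> F) :
  is_reflection eta i s ->
  mratfun_value (s X) v x' -> mratfun_value (s Y) v y' ->
  mratfun_value (s Z) v z' -> (forall j, mratfun_value (s (al j)) v (a' j)) ->
  f_ i != 0 /\
  [/\ x' = x + bracket_xy _ i * (a i / f_ i),
      y' = y + bracket_xy _ i * (a i / f_ i),
      z' = z + bracket_z _ i * (a i / f_ i)
    & forall j, a' j = weyl_refl i a j].
Proof.
move=> [_ [-> -> ->] sal _].
rewrite -(rmorph_bracket_xy (@tofrac mp)) -(rmorph_bracket_z (@tofrac mp)).
move=> Hx Hy Hz Ha.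
have d0 : f_ i != 0.
  have [i2|i2] := eqVneq i 2.
    apply: (shifted_value_den Hx); rewrite /bracket_xy i2 eqxx rmorph1.
    exact: oner_neq0.
  apply: (shifted_value_den Hz).
  by rewrite /bracket_z (negPf i2) rmorphN rmorph1 oppr_eq0 oner_neq0.
split=> //; split.
- by rewrite (shifted_value Hx d0) mevalXU (rmorph_bracket_xy (meval v)).
- by rewrite (shifted_value Hy d0) mevalXU (rmorph_bracket_xy (meval v)).
- by rewrite (shifted_value Hz d0) mevalXU (rmorph_bracket_z (meval v)).
move=> j; have := Ha j.
have -> : s (al j) = tofrac (weyl_refl i (al_poly F) j) / tofrac 1.
  rewrite sal tofrac1 divr1 (raddf_weyl_refl (@tofrac mp)).
  by apply: eq_weyl_refl => l; exact/esym/tofrac_al_poly.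
move=> /mratfun_valueE.
rewrite meval1 oner_neq0 divr1 => -> //; rewrite (raddf_weyl_refl (meval v)).
by apply: eq_weyl_refl => l; exact: meval_al_poly.
Qed.
End ReflectionValues.

(** * Transforming solutions *)

Lemma derive_addfrac (C : numFieldType) (u w g : C^o -> C^o) (k : C) (t : C^o) :
  derivable u t 1 -> derivable w t 1 -> w t != 0 ->
  {near t, (fun s => u s + k / w s) =1 g} ->
  derivable g t 1 /\ derive1 g t = derive1 u t - k * derive1 w t / w t ^+ 2.
Proof.
move=> du dw w0 gE.
have dwV := derivableV w0 dw.
have dq : is_derive t 1 (fun s => u s + k / w s : C^o)
    ('D_1 u t + k *: (- w t ^- 2 *: 'D_1 w t)).
  rewrite -(deriveV w0 dw); apply: is_deriveD; first exact: derivableP.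
  by apply: is_deriveZ; exact: derivableP.
have [dg gD] := near_eq_is_derive gE dq; split=> //.
rewrite !derive1E gD; congr (_ + _).
rewrite scaleNr scalerN; congr (- _).
by rewrite -[RHS]mulrA [_ * w t ^- 2]mulrC.
Qed.

Lemma derive1_divisor (C : numFieldType) (eta : C) i (x y z : C^o -> C^o)
    (t : C^o) (w : C^o -> C^o := fun s => divisor eta (x s) (y s) (z s) i) :
  derivable x t 1 -> derivable y t 1 -> derivable z t 1 ->
  derivable w t 1 /\ derive1 w t
    = [:: derive1 x t; derive1 x t; derive1 z t; derive1 y t; derive1 y t]`_i.
Proof.
move=> dx dy dz.
have shift (u : C^o -> C^o) (c : C) : derivable u t 1 ->
    derivable (fun s => u s - c : C^o) t 1
    /\ derive1 (fun s => u s - c : C^o) t = derive1 u t.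
  move=> du; rewrite !derive1E.
  have [] : is_derive t 1 (fun s => u s - c : C^o) ('D_1 u t - 0).
    by apply: is_deriveB; exact: derivableP.
  by rewrite subr0.
rewrite {}/w; elim/ord5_ind: i; rewrite /divisor /=.
- exact: shift.
- exact: (conj dx erefl).
- exact: (conj dz erefl).
- exact: shift.
- exact: (conj dy erefl).
Qed.

Section Backlund.
Variables (R : realType) (eta : R[i]) (b : {fraction {poly R[i]}}).
Local Notation C := R[i].

(** Near each point of U the new functions are v + {f, v} alpha_i / f with f = f_i
    nonzero, so that they are differentiable there.  Multiplying their
    derivatives by m = 2 eta / b yields the right-hand sides of
    [D4_equivariant]. *)
Lemma reflection_solves i (a : 'I_5 -> C) (U : set C)
    (x y z x' y' z' : C -> C) :
  open (U : set C^o) -> normalized a -> solves_D4 eta b a U x y z ->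
  (forall t, U t -> let d := divisor eta (x t) (y t) (z t) i in
    d != 0 /\ [/\ x' t = x t + bracket_xy _ i * (a i / d),
                   y' t = y t + bracket_xy _ i * (a i / d)
                 & z' t = z t + bracket_z _ i * (a i / d)]) ->
  solves_D4 eta b (weyl_refl i a) U x' y' z'.
Proof.
move=> oU na sol xyz' t Ut.
have [dx dy dz [c [bc c0 eqP eqQ eqR]]] := sol t Ut.
pose w (s : C^o) : C^o := divisor eta (x s) (y s) (z s) i.
have [w0 [x't y't z't]] := xyz' t Ut.
have [dw w'] : derivable w t 1 /\ derive1 w t = _ :=
  derive1_divisor eta i dx dy dz.
have nearU (u u' : C^o -> C^o) k :
    (forall s, U s -> u' s = u s + k * (a i / w s)) ->
    {near (t : C^o), (fun s => u s + k * a i / w s) =1 u'}.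
  move=> uu'; apply: filterS (open_nbhs_nbhs (conj oU Ut)) => s Us.
  by rewrite uu' // mulrA.
have [dx' x'E] := derive_addfrac dx dw w0
  (nearU _ _ _ (fun s Us => let: conj _ (And3 e _ _) := xyz' s Us in e)).
have [dy' y'E] := derive_addfrac dy dw w0
  (nearU _ _ _ (fun s Us => let: conj _ (And3 _ e _) := xyz' s Us in e)).
have [dz' z'E] := derive_addfrac dz dw w0
  (nearU _ _ _ (fun s Us => let: conj _ (And3 _ _ e) := xyz' s Us in e)).
pose m := 2 * eta / c.
have ddE : [:: D4P eta a (x t) (y t) (z t); D4P eta a (x t) (y t) (z t);
    D4R eta a (x t) (y t) (z t); - D4Q eta a (x t) (y t) (z t);
    - D4Q eta a (x t) (y t) (z t)]`_i = m * derive1 w t.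
  by rewrite w' -eqP -eqQ -eqR mulNr opprK; elim/ord5_ind: (i).
have scale (u k v r : C) : m * (u - k * v / r) = m * u - k * (m * v) / r.
  by ring.
have [] := D4_equivariant na w0.
rewrite ddE -eqP -eqQ -eqR -x't -y't -z't => hP hQ hR.
split; [exact: dx'|exact: dy'|exact: dz'|exists c].
split; [exact: bc|exact: c0|rewrite x'E|rewrite y'E|rewrite z'E].
- rewrite [LHS]scale; exact: (esym hP).
- apply: oppr_inj; rewrite mulNr opprK [LHS]scale.
  by move: hQ; rewrite mulNr opprK => hQ; exact: (esym hQ).
- rewrite [LHS]scale; exact: (esym hR).
Qed.

Lemma reflection_Backlund i s : is_reflection eta i s -> is_Backlund eta b s.
Proof.
move=> si; have [sC _ _ ss] := si.
split; first by split=> //; exists s.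
move=> a a' U x y z x' y' z' oU [t0 Ut0] na sol vals.
have val t (Ut : U t) := let: And4 vx vy vz va := vals t Ut in
  reflection_values na si vx vy vz va.
have -> : a' = weyl_refl i a.
  by apply: boolp.funext => j; have [_ [_ _ _ ->]] := val t0 Ut0.
split; first exact: weyl_refl_normalized.
apply: reflection_solves oU na sol _ => t Ut d.
by have [d0 [? ? ? _]] := val t Ut.
Qed.
End Backlund.

Theorem theorem2p2 (R : realType) (eta : R[i]) (b : {fraction {poly R[i]}})
    (eta_neq0 : eta != 0) (b_neq0 : b != 0) :
  exists s : 'I_5 -> {rmorphism D4field R[i] -> D4field R[i]},
    [/\ [/\ map (s 0) D4star = [:: X; Y; Z - al 0 / (X - D4const eta);
                                 - al 0; al 1; al 2 + al 0; al 3; al 4],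
            map (s 1) D4star = [:: X; Y; Z - al 1 / X;
                                 al 0; - al 1; al 2 + al 1; al 3; al 4],
            map (s 2) D4star = [:: X + al 2 / Z; Y + al 2 / Z; Z;
                                 al 0 + al 2; al 1 + al 2; - al 2;
                                 al 3 + al 2; al 4 + al 2],
            map (s 3) D4star = [:: X; Y; Z - al 3 / (Y - 1);
                                 al 0; al 1; al 2 + al 3; - al 3; al 4]
          & map (s 4) D4star = [:: X; Y; Z - al 4 / Y;
                                 al 0; al 1; al 2 + al 4; al 3; - al 4]],
        forall i, is_Backlund eta b (s i)
      & affine_Weyl_D4_relations (fun i f => s i f)].
Proof.
have [s sP] := fin_all_exists (reflection_exists eta).
exists s; split; last exact: reflection_relations sP.
  have star i : map (s i) D4star = reflected_star (D4const eta) X Y Z al i.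
    by have [_ [sX sY sZ] sal _] := sP i; rewrite /= sX sY sZ !sal.
  by rewrite !star; exact: reflected_starE.
by move=> i; exact: reflection_Backlund.
Qed.
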